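(* $N(2,2,2) = 10$.
   Context: For a finite set $X\subset\mathbb{R}^d$, $\mathrm{conv}(X)$ denotes its convex hull (with $\mathrm{conv}(\emptyset)=\emptyset$). For a positive integer $t$, a partition of a finite set $P\subset\mathbb{R}^d$ into $k$ pairwise disjoint subsets $P_1,\dots,P_k$ with union $P$ is called $t$-tolerant if for every set $Y\subset P$ of at most $t$ points, $\bigcap_{i=1}^k \mathrm{conv}(P_i\setminus Y)\neq\emptyset$. For positive integers $d,k,t$, $N(d,k,t)$ denotes the smallest positive integer $N$ such that every set $P$ of $N$ (distinct) points in $\mathbb{R}^d$ can be partitioned into $k$ subsets $P_1,\dots,P_k$ forming a $t$-tolerant partition. (Such an integer always exists.) *)

(* Defs.v *)
From HB Require Import structures.
From mathcomp Require Import all_boot all_order all_algebra finmap.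
From mathcomp Require Import boolp classical_sets reals topology convex.

Set Implicit Arguments.
Unset Strict Implicit.
Unset Printing Implicit Defensive.

Import Order.TTheory GRing.Theory Num.Theory.
Local Open Scope classical_set_scope.

(* R^d is 'rV[R]_d, and a finite point set is a {fset 'rV[R]_d}. *)

Definition conv_hull (R : realType) (d : nat) (X : {fset 'rV[R]_d}) :
    set 'rV[R]_d :=
  smallest (@convex_set R 'rV[R]_d) [set` X].

(* Parts may be empty here, as conv_hull fset0 = set0 already prevents an empty
   part in a t-tolerant partition. *)
Definition is_partition (R : realType) (d k : nat) (P : {fset 'rV[R]_d})
    (F : 'I_k -> {fset 'rV[R]_d}) : Prop :=
  (forall i j, i != j -> [disjoint F i & F j]%fset) /\
  [set` P] = \bigcup_(i : 'I_k) [set` F i].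

Definition tolerant_partition (R : realType) (d k t : nat)
    (P : {fset 'rV[R]_d}) (F : 'I_k -> {fset 'rV[R]_d}) : Prop :=
  is_partition P F /\
  forall Y : {fset 'rV[R]_d}, (Y `<=` P)%fset -> (#|` Y| <= t)%N ->
    \bigcap_(i : 'I_k) conv_hull (F i `\` Y)%fset !=set0.

Definition all_tolerant (R : realType) (d k t N : nat) : Prop :=
  forall P : {fset 'rV[R]_d}, #|` P| = N ->
    exists F : 'I_k -> {fset 'rV[R]_d}, tolerant_partition t P F.

(* The value defaults to 0 if no such positive integer exists. *)
Definition tolerantN (R : realType) (d k t : nat) : nat :=
  xget 0%N [set N : nat | [/\ (0 < N)%N, all_tolerant R d k t N &
    forall M : nat, (0 < M)%N -> all_tolerant R d k t M -> (N <= M)%N]].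

(* Main.v *)
Require Import Defs.
From mathcomp Require Import finmap boolp classical_sets reals convex.
From mathcomp Require Import unstable interval_inference.
From mathcomp Require Import all_boot all_order all_algebra.
From mathcomp Require Import zify ring.

(** Upper bound. Lift a point [x] of the plane to the vector [b = (1, x)] of
R^3. A 2-colouring is a choice of signs, and it is t-tolerant when, after
deleting any t of the signed vectors, a nontrivial nonnegative combination of
the others still vanishes. Such signs exist for any 3(t+1)+1 vectors, by
induction on t. An arrangement of planes through 0 in R^3 has a simplicial
cell: there is a set [A] of at most three of the vectors with signs such that
every other vector is, up to sign, in the cone they span. Choose signs outside
[A] by induction. Each vector outside [A] now lies either in the cone or in its
opposite, so for one of the two opposite signings of [A] at least t+1 of them
lie in the opposite of the cone. If the deleted set misses [A], one of these
survives and is dependent with [A]; otherwise fewer than t vectors are deleted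
outside [A].

Lower bound. There are nine points such that any 2-colouring is induced by a
line up to at most two points; deleting those points separates the hulls. *)

Set Implicit Arguments.
Unset Strict Implicit.
Unset Printing Implicit Defensive.

Import Order.TTheory GRing.Theory Num.Theory.
Local Open Scope ring_scope.

(** * Nonnegative combinations of vectors *)

Section PositiveCombinations.
Variables (R : realFieldType) (V : lmodType R) (I : finType).
Implicit Types (v : I -> V) (A B : {set I}) (w : V).

Definition pos_comb v A w :=
  exists2 l : I -> R, forall i, 0 <= l i & w = \sum_(i in A) l i *: v i.

(** Equivalently, 0 lies in the convex hull of the vectors indexed by [A]. *)
Definition pos_dependent v A :=
  exists l : I -> R, [/\ forall i, 0 <= l i, exists2 i, i \in A & 0 < l i
    & \sum_(i in A) l i *: v i = 0].

Lemma pos_comb_gen v A i : i \in A -> pos_comb v A (v i).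
Proof.
move=> iA; exists (fun j => (j == i)%:R) => [j|]; first exact: ler0n.
rewrite (bigD1 i) //= eqxx scale1r big1 ?addr0 // => j /andP[_ /negPf ->].
exact: scale0r.
Qed.

Lemma pos_comb_trans v v' A B w :
  (forall i, i \in A -> pos_comb v' B (v i)) -> pos_comb v A w ->
  pos_comb v' B w.
Proof.
move=> vAB [l l0 ->].
have /choice[k kP] : forall i, exists l' : I -> R, (forall j, 0 <= l' j) /\
    (i \in A -> v i = \sum_(j in B) l' j *: v' j).
  move=> i; have [/vAB[l' l'0 ->]|_] := boolP (i \in A); first by exists l'.
  by exists (fun=> 0).
exists (fun j => \sum_(i in A) l i * k i j) => [j|].
  by apply: sumr_ge0 => i _; rewrite mulr_ge0 ?(kP i).1.
under [RHS]eq_bigr do rewrite scaler_suml.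
rewrite exchange_big; apply: eq_bigr => i iA.
rewrite (kP i).2 // scaler_sumr; apply: eq_bigr => j _.
by rewrite scalerA.
Qed.

Lemma sub_pos_dependent v v' A B :
  A \subset B -> {in A, v =1 v'} -> pos_dependent v A -> pos_dependent v' B.
Proof.
move=> sAB vv' [l [l0 [i iA li] s0]].
exists (fun j => if j \in A then l j else 0); split.
- by move=> j; case: ifP.
- by exists i; [exact: (subsetP sAB) | rewrite iA].
apply: etrans s0; rewrite (big_setID A) /= (finset.setIidPr sAB).
rewrite [X in _ + X]big1 ?addr0.
  by apply: eq_bigr => j jA; rewrite jA vv'.
by move=> j; rewrite inE => /andP[/negPf -> _]; rewrite scale0r.
Qed.

Lemma pos_dependentU1 v A s :
  s \notin A -> pos_comb v A (- v s) -> pos_dependent v (s |: A).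
Proof.
move=> sA [l l0 e]; exists (fun j => if j == s then 1 else l j); split.
- by move=> j; case: ifP; rewrite ?ler01.
- by exists s; rewrite ?setU11 // eqxx.
rewrite big_setU1 //= eqxx scale1r -[v s]opprK e addrC.
apply/eqP; rewrite subr_eq0; apply/eqP; apply: eq_bigr => i iA.
by case: eqP iA sA => [->->|].
Qed.

Lemma pos_combNE v v' A w :
  {in A, forall i, v' i = - v i} -> pos_comb v A w -> pos_comb v' A (- w).
Proof.
move=> vv' [l l0 ->]; exists l => //; rewrite -sumrN.
by apply: eq_bigr => i iA; rewrite vv' // scalerN.
Qed.

End PositiveCombinations.

(** * Simplicial cells of central plane arrangements in R^3, and tolerant signs *)

Section SimplicialCell.
Variables (R : realFieldType) (I : finType) (b : I -> 'rV[R]_3).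
Implicit Types (e : I -> bool) (A S Y : {set I}).

Definition reorient e i := (-1) ^+ e i *: b i.

(** By duality: the form [b s] does not change sign on the cell where the reoriented vectors of [A]
    are nonnegative. *)
Definition in_cell A e s :=
  pos_comb (reorient e) A (b s) \/ pos_comb (reorient e) A (- b s).

Definition spans A S := forall s, s \in S ->
  exists l : I -> R, b s = \sum_(i in A) l i *: b i.

(** [A] indexes a maximal independent family of rows, and the rank is at most the number 3 of
    columns. *)
Lemma exists_spanning S : exists A, [/\ A \subset S, (#|A| <= 3)%N & spans A S].
Proof.
pose B := \matrix_(k < #|S|) b (enum_val k).
pose f := maxrankfun B; pose g k := enum_val (f k).
exists [set g k | k in 'I_(\rank B)]; split.
- by apply/subsetP => _ /imsetP[k _ ->]; exact: enum_valP.
- rewrite (leq_trans (leq_imset_card _ _)) // cardT size_enum_ord.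
  exact: rank_leq_col.
move=> s sS.
have /submxP[D DE] : (b s <= rowsub f B)%MS.
  rewrite eq_maxrowsub; have -> : b s = row (enum_rank_in sS s) B.
    by rewrite rowK enum_rankK_in.
  exact: row_sub.
have gi : injective g by move=> k k' /enum_val_inj /maxrankfun_inj.
(* [pick] inverts the injection [g]; indices outside its image get 0. *)
exists (fun i => if [pick k | g k == i] is Some k then D 0 k else 0).
rewrite big_imset /=; last by move=> ? ? _ _; exact: gi.
rewrite DE mulmx_sum_row; apply: eq_bigr => k _.
rewrite row_rowsub rowK; case: pickP => [k' /eqP/gi -> //|/(_ k)].
by rewrite eqxx.
Qed.

(* The hyperplane of [s] cuts the simplicial cone of the [u] that are
   nonnegative on the reoriented vectors of [A]. As this cone has at most three
   extreme rays, one of them, on which only [r] is nonzero, is alone on its side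
   of the hyperplane, and exchanging [r] for [s] keeps just that piece. *)
Lemma cell_exchange S A e s :
  A \subset S -> (#|A| <= 3)%N -> spans A S -> s \in S -> ~ in_cell A e s ->
  exists A' e', [/\ A' \subset S, (#|A'| <= 3)%N, spans A' S, in_cell A' e' s
    & forall j, in_cell A e j -> in_cell A' e' j].
Proof.
move=> AS A3 spA sS ncell; have [l bE] := spA s sS.
have sA : s \notin A.
  apply/negP => sA; apply: ncell; have := pos_comb_gen (reorient e) sA.
  rewrite /in_cell {2 4}/reorient.
  by case: (e s); rewrite ?expr1 ?expr0 ?scaleN1r ?scale1r; [right|left].
pose k i := (-1) ^+ e i * l i.
have kE i : k i *: reorient e i = l i *: b i.
  by rewrite scalerA mulrAC -signr_addb addbb mul1r.
have bkE : b s = \sum_(i in A) k i *: reorient e i.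
  by rewrite bE; apply: eq_bigr => i _; rewrite kE.
pose pos (q : bool) := [set i in A | 0 < (-1) ^+ q * k i].
(* Coefficients all of one weak sign would put [b s] or [- b s] in the cone, against [ncell]. *)
have pos_neq0 (q : bool) : (0 < #|pos q|)%N.
  rewrite card_gt0; apply/negP => /eqP/setP pq0; apply: ncell.
  have k0 i : i \in A -> (-1) ^+ q * k i <= 0.
    by move=> iA; move: (pq0 i); rewrite !inE iA /= => /negbT; rewrite -leNgt.
  have : pos_comb (reorient e) A (- ((-1) ^+ q *: b s)).
    exists (fun i => if i \in A then - ((-1) ^+ q * k i) else 0) => [i|].
      by case: ifP => // /k0; rewrite oppr_ge0.
    rewrite bkE scaler_sumr -sumrN; apply: eq_bigr => i ->.
    by rewrite scalerA scaleNr.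
  by case: (q); rewrite ?expr1 ?expr0 ?scaleN1r ?scale1r ?opprK; [left|right].
(* Of two disjoint nonempty subsets of a set of at most three elements, one is a singleton. *)
have [q /cards1P[r pqE]] : exists q, #|pos q| == 1%N.
  have dis : [disjoint pos false & pos true].
    rewrite -setI_eq0; apply/eqP/setP => i; rewrite !inE mul1r mulN1r oppr_gt0.
    by case: ltgtP; rewrite ?andbF.
  have : (#|pos false| + #|pos true| <= #|A|)%N.
    have /eqP <- : #|pos false :|: pos true| == (#|pos false| + #|pos true|)%N.
      by rewrite (leq_card_setU _ _).2.
    apply: subset_leq_card; apply/subsetP => i.
    by rewrite !inE => /orP[]/andP[].
  have := pos_neq0 false; have := pos_neq0 true.
  by have [|] := eqVneq #|pos false| 1%N; [exists false; apply/eqP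
    | exists true; apply/eqP; lia].
have [rA kr] : r \in A /\ 0 < (-1) ^+ q * k r.
  by apply/andP; have := set11 r; rewrite -pqE inE.
have ki i : i \in A :\ r -> (-1) ^+ q * k i <= 0.
  rewrite !inE => /andP[ir iA]; rewrite leNgt; apply/negP => kq.
  by have : i \in pos q; [rewrite inE iA | rewrite pqE inE (negPf ir)].
have lr : l r != 0.
  by apply: contraTneq kr => lr; rewrite /k lr !mulr0 ltxx.
have rs : r != s by apply: contraNneq sA => <-.
pose e' i := if i == s then q else e i.
have e'A i : i \in A -> reorient e' i = reorient e i.
  by move=> iA; rewrite /reorient /e'; case: eqP iA sA => // -> ->.
have sAr : s \notin A :\ r by rewrite inE (negPf sA) andbF.
have sE : reorient e' s = \sum_(i in A) ((-1) ^+ q * k i) *: reorient e i.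
  rewrite /reorient /e' eqxx bkE scaler_sumr.
  by apply: eq_bigr => i _; rewrite scalerA.
(* In [sE] only [r] has a positive coefficient, so solving for it gives nonnegative ones: the new
   cone contains the old. *)
have rcomb : pos_comb (reorient e') (s |: A :\ r) (reorient e r).
  exists (fun i => if i == s then ((-1) ^+ q * k r)^-1 else
    if i \in A :\ r then - ((-1) ^+ q * k i) / ((-1) ^+ q * k r) else 0).
    move=> i; case: ifP => _; first by rewrite invr_ge0 ltW.
    by case: ifP => // /ki kq; rewrite divr_ge0 ?oppr_ge0 // ltW.
  rewrite big_setU1 //= eqxx sE (big_setD1 r) //= scalerDr scalerA.
  rewrite mulVf ?gt_eqF // scale1r -addrA scaler_sumr -big_split.
  rewrite big1 ?addr0 // => i iAr /=.
  have iA : i \in A by case/setD1P: iAr.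
  rewrite iAr (negPf (memPn sAr i iAr)) e'A // scalerA -scalerDl.
  by rewrite mulNr mulrC subrr scale0r.
have trans w : pos_comb (reorient e) A w ->
    pos_comb (reorient e') (s |: A :\ r) w.
  apply: pos_comb_trans => i iA; have [->//|ir] := eqVneq i r.
  by rewrite -e'A //; apply: pos_comb_gen; rewrite !inE ir iA orbT.
exists (s |: A :\ r), e'; split.
- by rewrite subUset sub1set sS (subset_trans (subsetDl _ _)).
- by move: A3; rewrite cardsU1 sAr (cardsD1 r A) rA.
- move=> j /spA[m ->].
  (* Eliminate [b r] using [bE], where its coefficient [l r] is nonzero. *)
  exists (fun i => if i == s then m r / l r else m i - m r / l r * l i).
  rewrite big_setU1 //= eqxx bE (big_setD1 r) //= [in RHS](big_setD1 r) //=.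
  rewrite scalerDr scalerA divfK // -addrA; congr (_ + _).
  rewrite scaler_sumr -big_split; apply: eq_bigr => i iAr /=.
  by rewrite (negPf (memPn sAr i iAr)) scalerA -scalerDl addrC subrK.
- have : pos_comb (reorient e') (s |: A :\ r) (reorient e' s).
    by apply: pos_comb_gen; exact: setU11.
  rewrite /in_cell {2}/reorient /e' eqxx.
  by case: (q); rewrite ?expr1 ?expr0 ?scaleN1r ?scale1r; [right|left].
- by move=> j [] /trans c; [left | right].
Qed.

(** Exchanges terminate: each one keeps every vector already in the cell and adds [s], so the number
    of vectors outside drops. *)
Lemma exists_cell S : exists A e, [/\ A \subset S, (#|A| <= 3)%N
  & forall s, s \in S -> in_cell A e s].
Proof.
have [A [AS A3 sA]] := exists_spanning S.
pose out A e := #|[set s in S | ~~ `[< in_cell A e s >]]|.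
have [e _] : exists e : I -> bool, true by exists xpredT.
have [n] := ubnP (out A e); elim: n A e AS A3 sA => // n IH A e AS A3 sA on.
have [cell|/existsNP[s /not_implyP[sS ncell]]] :=
  pselect (forall s, s \in S -> in_cell A e s); first by exists A, e.
have [A' [e' [A'S A'3 sA' cs cj]]] := cell_exchange AS A3 sA sS ncell.
apply: (IH A' e') => //; move: on; rewrite ltnS; apply: leq_trans.
apply: proper_card; apply/properP; split.
  apply/subsetP => j; rewrite !inE => /andP[-> /=].
  by apply: contra => /asboolP /cj /asboolP.
exists s; rewrite !inE sS /=; first exact/asboolP.
by rewrite negbK; exact/asboolP.
Qed.

Lemma tolerant_signs m S : (3 * m < #|S|)%N ->
  exists e, forall Y, (#|Y| < m)%N -> pos_dependent (reorient e) (S :\: Y).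
Proof.
(* For [m = 0] the claim is vacuous: no [Y] has negative size. *)
elim: m S => [|m IH] S cS; first by exists xpredT.
have [A [e [AS A3 cell]]] := exists_cell S.
have cSA : (3 * m < #|S :\: A|)%N.
  by rewrite cardsDS //; lia.
have [e0 e0P] := IH _ cSA.
pose opp e1 := [set s in S :\: A | `[< pos_comb (reorient e1) A
  (- reorient e0 s) >]].
have [e1 e1P] : exists e1, (m < #|opp e1|)%N.
  pose ne i := ~~ e i.
  have : S :\: A \subset opp e :|: opp ne.
    apply/subsetP => s sSA; rewrite in_setU !inE -in_setD sSA /=.
    apply/orP; have : in_cell A e s by apply: cell; case/setDP: sSA.
    have nE : {in A, forall i, reorient ne i = - reorient e i}.
      move=> i _; rewrite /reorient /ne -scaleNr.
      by case: (e i); rewrite ?opprK.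
    rewrite /in_cell /reorient -/(reorient e) -/(reorient ne).
    case: (e0 s); rewrite ?expr0 ?expr1 ?scaleN1r ?scale1r ?opprK.
      case=> [c|/(pos_combNE nE)]; [left|rewrite opprK; right]; exact/asboolP.
    case=> [/(pos_combNE nE)|c]; [right|left]; exact/asboolP.
  (* The two sets cover more than [3 * m] elements, so one of them has more than [m]. *)
  move=> /subset_leq_card /leq_trans /(_ (leq_card_setU _ _).1) le.
  have [|le1] := ltnP m #|opp e|; first by exists e.
  by exists ne; lia.
exists (fun i => if i \in A then e1 i else e0 i) => Y cY.
(* If [Y] misses [A], its at most [m] elements cannot exhaust [opp e1]. *)
have [AY|[r /setIP[rA rY]]] := set_0Vmem (A :&: Y).
  have /subsetPn[s] : ~~ (opp e1 \subset Y).
    by apply/negP => /subset_leq_card; lia.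
  rewrite !inE => /andP[/andP[sA sS] /asboolP c] sY.
  apply: (@sub_pos_dependent _ _ _
    (reorient (fun i => if i \in A then e1 i else e0 i)) _ (s |: A)) => //.
    apply/subsetP => i; rewrite !inE => /orP[/eqP ->|iA].
      by rewrite sS sY.
    rewrite (subsetP AS) // andbT; apply/negP => iY.
    by move/setP/(_ i): AY; rewrite !inE iA iY.
  apply: pos_dependentU1 => //; rewrite {2}/reorient (negPf sA).
  case: c => l l0 ->; exists l => //; apply: eq_bigr => i iA.
  by rewrite /reorient iA.
(* Here [r] is in both [A] and [Y], so fewer than [m] elements are deleted outside [A]. *)
apply: sub_pos_dependent (e0P (Y :\: A) _).
- by apply/subsetP => i; rewrite !inE; case: (i \in A); rewrite ?andbF.
- by move=> i; rewrite /reorient !inE => /andP[_ /andP[/negPf -> _]].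
- have : Y :\: A \proper Y.
    apply/properP; split; first exact: subsetDl.
    by exists r => //; rewrite inE rA.
  by move/proper_card; lia.
Qed.

End SimplicialCell.

(** * Weighted averages in convex sets *)

Section ConvexSums.
Variables (R : realFieldType) (V : lmodType R).
Implicit Types (A : set V) (x y : V).

Lemma convex_setP A : @convex_set R V A <-> forall x y (s t : R),
  0 <= s -> 0 <= t -> s + t = 1 -> A x -> A y -> A (s *: x + t *: y).
Proof.
split=> [cA x y s t s0 t0 st Ax Ay|cA x y k /set_mem Ax /set_mem Ay].
  have s1 : s <= 1 by rewrite -st lerDl.
  have -> : t = s.~ by rewrite /onem -st addrC addKr.
  by have := cA x y (Itv01 s0 s1) (mem_set Ax) (mem_set Ay) => /set_mem.
by apply/mem_set/cA; rewrite // /onem ?subr_ge0 ?le1 // addrC subrK.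
Qed.

Lemma convex_sum A (I : Type) (r : seq I) (Q : pred I) (w : I -> R)
    (x : I -> V) :
  @convex_set R V A -> (forall i, 0 <= w i) -> (forall i, Q i -> A (x i)) ->
  0 < \sum_(i <- r | Q i) w i ->
  A ((\sum_(i <- r | Q i) w i)^-1 *: \sum_(i <- r | Q i) w i *: x i).
Proof.
move=> /convex_setP cA w0 Ax W0.
have [i0 Qi0] : exists i, Q i.
  apply/not_existsP => nQ; move: W0; rewrite big1 ?ltxx // => i Qi.
  by case: (nQ i).
(* Without the division, the claim also makes sense for zero total weight, so it passes through the
   induction on [r]. *)
suff [y Ay ->] : exists2 y, A y & \sum_(i <- r | Q i) w i *: x i
    = (\sum_(i <- r | Q i) w i) *: y.
  by rewrite scalerA mulVf ?scale1r // gt_eqF.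
elim: r {W0} => [|i r [y Ay IH]].
  by exists (x i0); rewrite ?big_nil ?scale0r //; exact: Ax.
rewrite !big_cons; case: ifP => Qi; last by exists y.
rewrite IH; set W := \sum_(_ <- _ | _) _.
have W0 : 0 <= W by exact: sumr_ge0.
have [wW|wW] := eqVneq (w i + W) 0.
  exists y => //; move/eqP: wW; rewrite paddr_eq0 // => /andP[/eqP -> /eqP ->].
  by rewrite addr0 !scale0r addr0.
exists ((w i / (w i + W)) *: x i + (W / (w i + W)) *: y).
  apply: cA (Ax i Qi) Ay; last by rewrite -mulrDl mulfV.
    by rewrite divr_ge0 // addr_ge0.
  by rewrite divr_ge0 // addr_ge0.
by rewrite scalerDr !scalerA ![_ * (_ / _)]mulrC !divfK.
Qed.

End ConvexSums.

(** * From signs to tolerant partitions of the plane *)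

Section UpperBound.
Variable R : realType.

Lemma conv_hull_convex d (X : {fset 'rV[R]_d}) :
  @convex_set R 'rV[R]_d (conv_hull X).
Proof.
apply/convex_setP => x y s t s0 t0 st hx hy C [/= /[dup] cC /convex_setP cC' XC].
by apply: cC' => //; [apply: hx | apply: hy].
Qed.

(** Signs are colours. In a vanishing combination of signed lifts, the first coordinate equates the
    total weights of the two colours and the others their weighted sums, so both hulls contain the
    same weighted average. *)
Lemma all_tolerant2 t N : (3 * t.+1 < N)%N -> all_tolerant R 2 2 t N.
Proof.
move=> tN P cP.
pose b (p : P) : 'rV[R]_(1 + 2) := row_mx 1%:M (val p).
have [|e eP] := @tolerant_signs R P b t.+1 [set: P].
  by rewrite cardsT -cardfE cP.
pose F (i : 'I_2) := [fset val p | p : P & e p == (i == 1)]%fset.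
have FP i (p : P) : (val p \in F i) = (e p == (i == 1)).
  apply/imfsetP/idP => [[q /=]|ep]; last by exists p.
  by move=> eq /val_inj ->.
have FsubP i x : x \in F i -> exists2 p : P, x = val p & e p == (i == 1).
  by case/imfsetP => p /= ep ->; exists p.
exists F; split; [split|].
- move=> i j ij; apply/fdisjointP => x /FsubP[p -> /eqP ep].
  rewrite FP ep; apply: contra ij.
  by case: i j {ep} => [[|[|//]] ?] [[|[|//]] ?].
- apply/seteqP; split=> x /=.
    move=> xP; exists (if e [` xP]%fset then 1 else 0) => //=.
    by rewrite -[x]/(val [` xP]%fset) FP; case: (e _).
  by case=> i _ /= /FsubP[p -> _]; exact: valP.
move=> Y YP cY.
have [|l [l0 [p0 pY lp] ls]] := eP [set p | val p \in Y].
  rewrite ltnS (leq_trans _ cY) // cardE -(size_map val).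
  apply: uniq_leq_size; first by rewrite (map_inj_uniq val_inj) enum_uniq.
  by move=> x /mapP[q]; rewrite mem_enum inE => qY ->.
rewrite finset.setTD in pY ls.
pose D (q : bool) p := (p \in ~: [set p | val p \in Y]) && (e p == q).
pose L q := \sum_(p | D q p) l p; pose X q := \sum_(p | D q p) l p *: val p.
have GE q : \sum_(p | D q p) l p *: b p = row_mx (L q)%:M (X q).
  apply/rowP => j; rewrite summxE -[j]splitK /L /X.
  case: (split j) => k /=.
    rewrite row_mxEl mxE ord1 eqxx mulr1n; apply: eq_bigr => p1 _.
    by rewrite mxE row_mxEl mxE eqxx mulr1.
  rewrite row_mxEr summxE; apply: eq_bigr => p1 _.
  by rewrite mxE row_mxEr mxE.
have [LE XE] : L true = L false /\ X true = X false.
  suff : row_mx (L false)%:M (X false) = row_mx (L true)%:M (X true).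
    by case/eq_row_mx => /matrixP/(_ 0 0); rewrite !mxE eqxx.
  apply/eqP; rewrite -subr_eq0 -!GE; apply/eqP; rewrite -[RHS]ls [RHS](bigID e).
  rewrite /= [LHS]addrC -sumrN; congr (_ + _); apply: eq_big => p.
  - by rewrite /D eqb_id.
  - by rewrite /D => /andP[_ /eqP ep]; rewrite /reorient ep scaleN1r scalerN.
  - by rewrite /D eqbF_neg.
  - by rewrite /D => /andP[_ /eqP ep]; rewrite /reorient ep scale1r.
have L0 : 0 < L false.
  have Lge q : 0 <= L q by exact: sumr_ge0.
  have : 0 < L (e p0).
    by rewrite /L (bigD1 p0) /D ?pY /= ?ltr_wpDr ?sumr_ge0.
  by case: (e p0); rewrite ?LE.
exists ((L false)^-1 *: X false) => i _ /=.
have -> : (L false)^-1 *: X false = (L (i == 1))^-1 *: X (i == 1).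
  by case: (i == 1); rewrite ?LE ?XE.
apply: convex_sum => //; first exact: conv_hull_convex.
  move=> q /andP[qY eq]; apply: sub_gen_smallest => /=.
  by rewrite in_fsetD FP eq andbT; rewrite !inE in qY.
by rewrite -/(L (i == 1)); case: (i == 1); rewrite ?LE.
Qed.

End UpperBound.

(* Nine points whose every 2-colouring differs in at most two points from one
   induced by a line. Found by random search. *)
Definition nine_points : seq (int * int) :=
  [:: (1, 3); (3, -2); (-4, -1); (0, -4); (-2, 2); (2, 4); (-3, 2); (1, 4);
      (0, 1)].

(* [(a, b, c)] stands for the form [a * x + b * y + c]. *)
Definition affine_forms : seq (int * int * int) :=
  [:: (1, -1, 0); (2, -2, 5); (-2, 5, -15); (-2, -6, 7); (-2, 0, -7);
      (-2, 2, -7); (3, 4, -3); (2, 0, -3); (-1, -1, -2); (0, 1, 3);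
      (-2, 0, 5); (2, -4, 13); (-2, -3, 1); (5, -1, 0); (6, -4, 5);
      (10, -12, 27); (2, 0, -1); (-2, 8, -21); (-16, 2, 9); (-2, -1, -3);
      (-2, 2, -9); (0, -2, 3)].

(* [misclassified l o p c]: the point [p] of colour [c] is not strictly on the
   side of the line [l = 0] that the orientation [o] assigns to colour [c]. *)
Definition misclassified (l : int * int * int) (o : bool) (p : int * int)
    (c : bool) : bool :=
  (-1) ^+ (o (+) ~~ c) * (l.1.1 * p.1 + l.1.2 * p.2 + l.2) <= 0.

Fixpoint bitseqs n : seq bitseq :=
  if n is m.+1 then map (cons true) (bitseqs m) ++ map (cons false) (bitseqs m)
  else [:: [::]].

Lemma mem_bitseqs (s : bitseq) : s \in bitseqs (size s).
Proof.
by elim: s => // [[]] s IH; rewrite mem_cat map_f ?orbT.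
Qed.

(** Only the nine values of [c] on the points matter, so evaluating all 512 colourings against
    [affine_forms] suffices. *)
Lemma nine_points_classified (c : int * int -> bool) :
  exists l o, (count (fun p => misclassified l o p (c p)) nine_points <= 2)%N.
Proof.
pose errors l o s :=
  count (fun pb => misclassified l o pb.1 pb.2) (zip nine_points s).
have /allP check : all (fun s => has (fun l =>
    has (fun o => errors l o s <= 2)%N [:: false; true]) affine_forms) (bitseqs 9).
  by vm_compute.
have /check/hasP[l _ /hasP[o _]] := mem_bitseqs (map c nine_points).
rewrite /errors -[X in zip X](map_id nine_points) zip_map count_map => le2.
by exists l, o.
Qed.

(** * Separation of the two hulls by open half-planes *)

Section LowerBound.
Variable R : realType.

Definition int_pt (p : int * int) : 'rV[R]_2 :=
  \row_j (if j == 0 then p.1 else p.2)%:~R.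

Lemma int_pt_inj : injective int_pt.
Proof.
move=> [x y] [x' y'] /rowP e; have := e 1; have := e 0; rewrite !mxE /=.
by move=> /intr_inj -> /intr_inj ->.
Qed.

Definition half_plane (s : R) (l : int * int * int) : set 'rV[R]_2 :=
  [set v | 0 < s * (l.1.1%:~R * v 0 0 + l.1.2%:~R * v 0 1 + l.2%:~R)]%classic.

Lemma half_plane_convex s l : @convex_set R 'rV[R]_2 (half_plane s l).
Proof.
apply/convex_setP => x y u t u0 t0 ut; rewrite /half_plane /= !mxE.
case: l => [[a b] c] /= hx hy.
rewrite [X in 0 < X](_ : _ = u * (s * (a%:~R * x 0 0 + b%:~R * x 0 1 + c%:~R))
  + t * (s * (a%:~R * y 0 0 + b%:~R * y 0 1 + c%:~R))); last first.
  have -> : u = 1 - t by rewrite -ut addrK.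
  by ring.
(* Strict positivity must come from a nonzero weight: [u = 1] if [t = 0], and [t] otherwise. *)
move: t0; rewrite le_eqVlt eq_sym => /predU1P[tE|t0].
  by move: ut; rewrite tE addr0 => ->; rewrite mul1r mul0r addr0.
apply: ltr_wpDl; last exact: mulr_gt0.
exact: mulr_ge0 u0 (ltW hx).
Qed.

Lemma half_plane_int_pt (l : int * int * int) (o c : bool) p :
  ~~ misclassified l o p c -> half_plane ((-1) ^+ (o (+) ~~ c)) l (int_pt p).
Proof.
rewrite /misclassified -ltNge /half_plane /= !mxE /=.
rewrite -(ltr0z R) rmorphM /= !rmorphD !rmorphM /=.
by case: (o (+) ~~ c); rewrite ?expr1 ?expr0 ?rmorphN1 ?rmorph1.
Qed.

Lemma conv_hull_half_plane (X : {fset 'rV[R]_2}) s l :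
  (forall x, x \in X -> half_plane s l x) ->
  (conv_hull X `<=` half_plane s l)%classic.
Proof. by apply: smallest_sub; exact: half_plane_convex. Qed.

Lemma not_all_tolerant222 N : (N <= 9)%N -> ~ all_tolerant R 2 2 2 N.
Proof.
(* A prefix of the nine points serves for each [N], since deleting points creates no new errors. *)
move=> N9; pose P := [fset x in map int_pt (take N nine_points)]%fset.
have cP : #|` P| = N.
  rewrite card_fseq undup_id ?size_map ?size_takel //.
  by rewrite (map_inj_uniq int_pt_inj) take_uniq.
move=> /(_ P cP)[F [[disF PF] tolF]].
have FP i x : x \in F i -> x \in P.
  by move=> xF; have : [set` P]%classic x by rewrite PF; exists i.
pose c p := int_pt p \in F 0.
have [l [o errs]] := nine_points_classified c.
pose errors := [seq p <- nine_points | misclassified l o p (c p)].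
pose Y := (P `&` [fset x in map int_pt errors])%fset.
have cY : (#|` Y| <= 2)%N.
  rewrite (leq_trans (fsubset_leq_card (fsubsetIr _ _))) // card_fseq.
  by rewrite (leq_trans (size_undup _)) // size_map size_filter.
have hull i : (conv_hull (F i `\` Y)%fset
    `<=` half_plane ((-1) ^+ (o (+) (i == 1))) l)%classic.
  apply: conv_hull_half_plane => x; rewrite in_fsetD => /andP[xY xF].
  have xP := FP _ _ xF; move: (xP); rewrite in_fset => /mapP[p pN xE].
  have ci : c p = ~~ (i == 1).
    rewrite /c -xE; have [i1|i1] := eqVneq i 1.
      apply/negP => xF0; have /fdisjointP/(_ _ xF0) : [disjoint F 0 & F i]%fset.
        by apply: disF; rewrite i1.
      by rewrite xF.
    suff -> : 0 = i by [].
    by apply: val_inj; case: (i) i1 => [[|[|]]].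
  rewrite xE -[i == 1]negbK -ci; apply: half_plane_int_pt.
  apply: contra xY => mis; rewrite in_fsetI xP in_fset xE /=; apply: map_f.
  by rewrite mem_filter mis (mem_take pN).
have [v vF] := tolF Y (fsubsetIl _ _) cY.
(* A common point of the hulls would lie strictly on both sides of the line. *)
have := hull 1 _ (vF 1 I); have := hull 0 _ (vF 0 I).
rewrite /half_plane /= addbT addbF signrN mulNr oppr_gt0 => /lt_trans h /h.
by rewrite ltxx.
Qed.

End LowerBound.

Theorem theorem5 (R : realType) : tolerantN R 2 2 2 = 10%N.
Proof.
apply: xget_unique.
  split=> // [|M _ aM]; first exact: all_tolerant2.
  by rewrite leqNgt; apply/negP => M10; exact: not_all_tolerant222 aM.
move=> M [M0 aM Mmin]; apply/eqP; rewrite eqn_leq Mmin //=; last first.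
  exact: all_tolerant2.
by rewrite leqNgt; apply/negP => M10; exact: not_all_tolerant222 aM.
Qed.
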